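(* Let $X$ be a Banach space and let $A\subseteq X$ be convex and bounded. Then $\mathrm{SCD}\bigl(\overline{A}\bigr)\cap A=\mathrm{SCD}(A)$.
   Context: Banach spaces are over $\mathbb{K}=\mathbb{R}$ or $\mathbb{C}$; $X^*$ denotes the topological dual of $X$, and $\overline{A}$ is the norm closure of $A$. A slice of a bounded set $A\subseteq X$ is a non-empty intersection of $A$ with an open half-space; it can be written as $S(A,x^*,\alpha)=\{x\in A:\operatorname{Re}x^*(x)>\sup_{b\in A}\operatorname{Re}x^*(b)-\alpha\}$ with $x^*\in X^*$, $\alpha>0$. Let $A\subseteq X$ be bounded and convex and $a\in A$. A countable collection $\{V_n:n\in\mathbb{N}\}$ of non-empty subsets of $A$ is determining for $a$ if $a\in\overline{\mathrm{conv}}(B)$ whenever $B\subseteq A$ intersects all the sets $V_n$. The point $a$ is an SCD point (slicely countably determined point) of $A$ if there is a sequence of slices of $A$ that is determining for $a$; $\mathrm{SCD}(A)$ is the set of all SCD points of $A$. *)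

(* Defs.v *)
From HB Require Import structures.
From mathcomp Require Import all_boot all_order all_algebra.
From mathcomp Require Import all_classical all_reals all_analysis.
From mathcomp.real_closed Require Export complex.

Set Implicit Arguments.
Unset Strict Implicit.
Unset Printing Implicit Defensive.

Import Order.TTheory GRing.Theory Num.Theory.
Import numFieldNormedType.Exports.

Local Open Scope classical_set_scope.
Local Open Scope ring_scope.

(* [re] is the real part on the scalar field [K]: it is [id] when [K] is [R]
   and [complex.Re] when [K] is [R[i]]. *)
Section SCD.
Variables (R : realType) (K : numFieldType) (re : K -> R).
Variable X : normedModType K.
Implicit Types (A B S : set X) (V : nat -> set X) (a : X).

Definition slice A (f : {linear X -> K^o}) (alpha : R) : set X :=
  [set x | A x /\ sup [set re (f b) | b in A] - alpha < re (f x)].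

Definition is_slice A S : Prop :=
  S !=set0 /\
  exists (f : {linear X -> K^o}) (alpha : R),
    [/\ continuous f, 0 < alpha & S = slice A f alpha].

(* The scalar order of [R[i]] makes the coefficients of [convex_set] range over
   the real interval [0, 1] in the complex case too. *)
Definition conv_hull B : set X := smallest (@convex_set K X) B.

Definition determining A V a : Prop :=
  (forall n, V n !=set0 /\ V n `<=` A) /\
  (forall B, B `<=` A -> (forall n, (B `&` V n) !=set0) ->
     closure (conv_hull B) a).

Definition SCD A : set X :=
  [set a | A a /\
     exists V, (forall n, is_slice A (V n)) /\ determining A V a].

End SCD.

(* Main.v *)
Require Import Defs.
From HB Require Import structures.
From mathcomp Require Import all_boot all_order all_algebra.
From mathcomp Require Import all_classical all_reals all_analysis.
Import Order.TTheory GRing.Theory Num.Theory.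
Import numFieldNormedType.Exports.
Local Open Scope classical_set_scope.
Local Open Scope ring_scope.

(** The sets [A] and [closure A] have matching slices. A functional [re \o f]
has the same supremum over both, so cutting the two sets by [f] at level [alpha]
gives slices [S] of [A] and [S'] of [closure A] with [S' `&` A = S]; moreover
[S'] lies in the closure of [S], because a point of [closure A] in an open
half-space is a limit of points of [A] in that half-space.

If slices [V n] of [closure A] are determining for [a], so are their traces
[V n `&` A], since a subset of [A] that meets all the traces also meets all the
[V n].

Conversely, let slices [V n] of [A] be determining for [a], and let [W n] be the
matching slices of [closure A]. A subset [B] of [closure A] meeting every [W n]
may be disjoint from [A], but it can be moved into [A]: for [e > 0], the set of
points of [A] within [e] of [B] meets every [V n], because a point of [W n] is a
limit of points of [V n]. Its convex hull therefore comes arbitrarily close to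
[a], and that hull stays within [e] of the convex hull of [B]
([closure_conv_hull_approx]). Letting [e] tend to 0 puts [a] in the closed
convex hull of [B].

The real part enters through its continuity, which lets [SCD_closureI] treat
both scalar fields at once. *)

Lemma closure_setI_open (T : topologicalType) (A U : set T) :
  open U -> closure A `&` U `<=` closure (A `&` U).
Proof.
move=> oU x [clAx Ux] N Nx; rewrite -setIA (setIC U); apply: clAx.
by apply: filterI => //; exact: open_nbhs_nbhs.
Qed.

(** By continuity both images have the same upper bounds, and [sup] depends only
on these for non-empty images: without upper bounds, both sides are the default
value of [sup]. *)
Lemma sup_image_closure (R : realType) (T : topologicalType) (g : T -> R)
    (A : set T) :
  continuous g -> sup (g @` closure A) = sup (g @` A).
Proof.
move=> gc; have [->|/set0P[a Aa]] := eqVneq A set0; first by rewrite closure0.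
have ubE : ubound (g @` closure A) = ubound (g @` A).
  apply/seteqP; split=> u ub_u _ [x Ax <-].
    by apply: ub_u; exists x => //; exact: subset_closure.
  have /closure_id cl_le : closed (g @^-1` [set r | r <= u]).
    by apply: closed_comp => [y _|]; [exact: gc | exact: closed_le].
  change ((g @^-1` [set r | r <= u]) x); rewrite cl_le.
  by apply: closureS Ax => y Ay; apply: ub_u; exists y.
have n0 (B : set T) : B a -> (g @` B == set0) = false.
  by move=> Ba; apply/negbTE/set0P; exists (g a), a.
by rewrite /sup /supremum /supremums ubE !n0 //; exact: subset_closure.
Qed.

(** The witness for a convex combination is the same combination of the two
witnesses; the triangle inequality bounds the error by [t * e + (1 - t) * e].
The weights are taken strictly between 0 and 1 so that the inequality stays
strict. *)
Lemma convex_set_thickening (K : numFieldType) (X : normedModType K) (C : set X)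
    (e : K) :
  @convex_set K X C -> @convex_set K X [set x | exists2 y, C y & ball x e y].
Proof.
move=> cC; apply/convex_setW => x1 x2 /[!inE] -[y1 Cy1 xy1] [y2 Cy2 xy2] t t0 t1.
apply/mem_set; exists (t%:num *: y1 + (1 - t%:num) *: y2).
  by have := cC y1 y2 t; rewrite !inE; apply.
move: xy1 xy2; rewrite -!ball_normE /= => xy1 xy2.
have -> : @conv K (convex_lmodType X) t x1 x2 =
    t%:num *: (x1 : X) + (1 - t%:num) *: (x2 : X) by [].
rewrite opprD addrACA -!scalerBr.
apply: le_lt_trans (ler_normD _ _) _; rewrite !normrZ.
have u0 : 0 < (1 - t%:num) by rewrite subr_gt0.
rewrite (gtr0_norm t0) (gtr0_norm u0).
have -> : e = t%:num * e + (1 - t%:num) * e by rewrite -mulrDl addrC subrK mul1r.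
by apply: ltrD; rewrite ltr_pM2l.
Qed.

(** Membership in a closed convex hull is stable under small perturbations of
the set: the [e]-neighbourhood of the hull of [B] is convex and contains [B'],
hence contains the hull of [B']. *)
Lemma closure_conv_hull_approx (K : numFieldType) (X : normedModType K)
    (B : set X) (a : X) :
  (forall e : K, 0 < e -> exists2 B' : set X,
     (forall x, B' x -> exists2 b, B b & ball x e b) &
     closure (conv_hull B') a) ->
  closure (conv_hull B) a.
Proof.
move=> approx N /nbhs_ballP[e /= e0 eN].
have e20 : 0 < e / 2 by rewrite divr_gt0.
have [B' B'B clB'a] := approx _ e20.
have [x [B'x ax]] := clB'a _ (nbhsx_ballx _ _ e20).
have : [set x | exists2 y, conv_hull B y & ball x (e / 2) y] x.
  apply: (smallest_sub _ _ B'x) => [|z /B'B[b Bb zb]].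
    apply: convex_set_thickening => y z t /[!inE] By Bz C [cC BC].
    by have := cC y z t; rewrite !inE; apply; [exact: By | exact: Bz].
  by exists b => //; exact: sub_gen_smallest.
move=> [y By xy]; exists y; split=> //.
by apply: eN; apply: ball_split ax xy.
Qed.

Section closure_SCD.
Context {R : realType} {K : numFieldType} (re : K -> R).
Hypothesis re_cont : continuous (re : K^o -> R).
Variable X : normedModType K.
Implicit Types (A S : set X) (f : {linear X -> K^o}) (alpha : R).

Lemma sup_functional_closure A f : continuous f ->
  sup [set re (f b) | b in closure A] = sup [set re (f b) | b in A].
Proof.
move=> fc; apply: (@sup_image_closure R X (re \o f)) => x.
by apply: continuous_comp; [exact: fc | exact: re_cont].
Qed.

Lemma slice_closureI A f alpha : continuous f ->
  slice re (closure A) f alpha `&` A = slice re A f alpha.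
Proof.
move=> fc; apply/seteqP; rewrite /slice sup_functional_closure //.
split=> x /=; [by move=> [[_ ?] ?] | move=> [Ax ?]; split=> //].
by split=> //; exact: subset_closure.
Qed.

(** This density turns points of slices of [closure A] into nearby points of the
matching slices of [A]. *)
Lemma slice_closure_sub A f alpha : continuous f ->
  slice re (closure A) f alpha `<=` closure (slice re A f alpha).
Proof.
move=> fc x; rewrite /slice sup_functional_closure // => -[clAx fx].
apply: (@closure_setI_open _ A
  ((re \o f) @^-1` [set r | sup [set re (f b) | b in A] - alpha < r])) => //.
apply: open_comp => [y _|]; last exact: open_gt.
by apply: continuous_comp; [exact: fc | exact: re_cont].
Qed.

(** The trace is non-empty because [S] lies in the closure of the trace. *)
Lemma is_slice_closureI A S :
  is_slice re (closure A) S -> is_slice re A (S `&` A).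
Proof.
move=> [[x Sx] [f [alpha [fc alpha0 SE]]]]; rewrite SE in Sx *.
rewrite slice_closureI //; split; last by exists f, alpha.
have [y [Ay _]] := slice_closure_sub _ _ _ fc _ Sx _ filterT.
by exists y.
Qed.

Lemma is_slice_extend A S : is_slice re A S ->
  exists S', is_slice re (closure A) S' /\ S' `<=` closure S.
Proof.
move=> [[x Sx] [f [alpha [fc alpha0 SE]]]]; rewrite SE in Sx *.
exists (slice re (closure A) f alpha).
have sub : slice re A f alpha `<=` slice re (closure A) f alpha.
  by rewrite -slice_closureI // => y [].
split; last exact: slice_closure_sub.
by split; [exists x; exact: sub | exists f, alpha].
Qed.

Lemma SCD_closureI A : SCD re (closure A) `&` A = SCD re A.
Proof.
apply/seteqP; split=> a.
  move=> [[_ [V [sV [_ detV]]]] Aa]; split=> //.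
  exists (fun n => V n `&` A); have sVA n := is_slice_closureI _ _ (sV n).
  split=> //; split=> [n|B BA BV]; first by split=> [|y []//]; case: (sVA n).
  apply: detV => [|n]; first exact: subset_trans BA (@subset_closure _ A).
  by have [x [Bx [Vx _]]] := BV n; exists x.
move=> [Aa [V [sV [_ detV]]]]; split=> //; split; first exact: subset_closure.
have [W sW] := choice (fun n => is_slice_extend _ _ (sV n)).
exists W; split=> [n|]; first by case: (sW n).
split=> [n|B BA BW].
  by have [[W0 [f [alpha [_ _ WE]]]] _] := sW n; split=> // x; rewrite WE => -[].
apply: closure_conv_hull_approx => e e0.
exists [set x | A x /\ exists2 b, B b & ball x e b]; first by move=> x [].
apply: detV => [x []//|n].
have [_ WV] := sW n; have [b [Bb /WV clVb]] := BW n.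
have [x [Vx bx]] := clVb _ (nbhsx_ballx _ _ e0).
exists x; split=> //; split; last by exists b => //; exact: ball_sym.
by have [_ [f [alpha [_ _ VE]]]] := sV n; move: Vx; rewrite VE => -[].
Qed.

End closure_SCD.

(** The real part is 1-Lipschitz. *)
Lemma continuous_Re (R : realType) :
  continuous (@complex.Re R : (complex R)^o -> R).
Proof.
move=> z; apply/(@cvgrPdist_lt _ R _ _ (nbhs_filter (z : (complex R)^o))) => e e0.
exists (e%:C)%C => /= [|w zw]; first by rewrite ltcR.
by rewrite -raddfB -ltcR; exact: le_lt_trans (normc_ge_Re _) zw.
Qed.

Theorem lemma2p7 (R : realType) :
  (forall (X : completeNormedModType R) (A : set X),
     @convex_set R X A -> bounded_set A ->
     SCD (@id R) (closure A) `&` A = SCD (@id R) A) /\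
  (forall (X : completeNormedModType (complex R)) (A : set X),
     @convex_set (complex R) X A -> bounded_set A ->
     SCD (@complex.Re R) (closure A) `&` A = SCD (@complex.Re R) A).
Proof.
split=> X A _ _; apply: SCD_closureI; last exact: continuous_Re.
by move=> x; exact: cvg_id.
Qed.
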